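(* Let $P$ be a polyanalytic polynomial of degree $n$ with only finitely many zeros in $\mathbb{C}$. (i) If $P$ is reducible, say $P=P_1\cdots P_k$ with $k\geq 2$ polyanalytic polynomials $P_j$ of degree $\deg(P_j)=n_j\geq 1$, then $P$ has at most $\sum_{j=1}^k n_j^2$ zeros, and $\sum_{j=1}^k n_j^2<n^2$. (ii) If $n\geq 2$ and $P$ has at least $n^2-2n+3$ zeros, then $P$ is irreducible.
   Context: A polyanalytic polynomial is a function $\mathbb{C}\to\mathbb{C}$ of the form $P(z,\bar z)=\sum_{j+k\le n}\alpha_{j,k} z^j \bar z^{k}$ with complex coefficients (a polynomial in $z$ and $\bar z$); two such polynomials are equal iff all coefficients agree. Its degree is the largest $j+k$ with $\alpha_{j,k}\neq 0$. $P$ is reducible if $P=P_1P_2$ for polyanalytic polynomials with $\deg(P_1),\deg(P_2)\geq 1$, and irreducible otherwise. A zero of $P$ is a point $z\in\mathbb{C}$ with $P(z,\bar z)=0$; zeros are counted as distinct points. *)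

(* Defs.v *)
From HB Require Import structures.
From mathcomp Require Import all_boot all_order all_algebra.
From mathcomp Require Import complex.
From mathcomp Require Import reals.
From mathcomp Require Import mpoly.
Set Implicit Arguments. Unset Strict Implicit. Unset Printing Implicit Defensive.
Import GRing.Theory Num.Theory.
Local Open Scope ring_scope.

(* The complex numbers are modelled as [R[i]] for [R : realType]
   (every realType is the complete ordered field of real numbers).
   A polyanalytic polynomial P(z, zbar) = sum alpha_{j,k} z^j zbar^k is an
   element of {mpoly R[i][2]}: variable 'X_0 stands for z, 'X_1 for zbar. *)

Definition polyan (R : realType) := {mpoly R[i][2]}.

Definition pa_eval (R : realType) (P : {mpoly R[i][2]}) (z : R[i]) : R[i] :=
  P.@[[ffun i : 'I_2 => if i == ord0 then z else conjc z]].

(* Degree = largest total degree j+k of a monomial with nonzero coefficient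
   (msize P = degree + 1 for P <> 0). *)
Definition pa_deg (R : realType) (P : {mpoly R[i][2]}) : nat := (msize P).-1.

Definition pa_zero (R : realType) (P : {mpoly R[i][2]}) (z : R[i]) : Prop :=
  pa_eval P z = 0.

Definition pa_finite_zeros (R : realType) (P : {mpoly R[i][2]}) : Prop :=
  exists s : seq R[i], forall z, pa_zero P z -> z \in s.

Definition pa_at_most_zeros (R : realType) (P : {mpoly R[i][2]}) (N : nat) : Prop :=
  forall s : seq R[i], uniq s -> (forall z, z \in s -> pa_zero P z) -> (size s <= N)%N.

Definition pa_at_least_zeros (R : realType) (P : {mpoly R[i][2]}) (N : nat) : Prop :=
  exists s : seq R[i], [/\ uniq s, (forall z, z \in s -> pa_zero P z) & (N <= size s)%N].

Definition pa_reducible (R : realType) (P : {mpoly R[i][2]}) : Prop :=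
  exists P1 P2 : {mpoly R[i][2]},
    [/\ P = P1 * P2, (1 <= pa_deg P1)%N & (1 <= pa_deg P2)%N].

Definition pa_irreducible (R : realType) (P : {mpoly R[i][2]}) : Prop :=
  ~ pa_reducible P.

(* Main.v *)
Require Import Defs.
From HB Require Import structures.
From mathcomp Require Import all_boot all_order all_algebra perm.
From mathcomp Require Import boolp complex polyrcf reals mpoly zify ring lra.
Import Order.TTheory GRing.Theory Num.Theory.
Local Open Scope ring_scope.
Set Implicit Arguments. Unset Strict Implicit. Unset Printing Implicit Defensive.

(* A polynomial Q <> 0 with finitely many zeros has at most (deg Q)^2 of them;
   summing this over the factors gives both claims.  By induction on the degree
   Q may be taken irreducible.  Its zeros (z, conj z) are also zeros of the
   conjugate polynomial Q*.  If Q does not divide Q*, Bezout applies to Q and Q*.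
   Otherwise a scalar multiple of Q is real on the points (z, conj z); an isolated
   zero of a real function of two variables is critical by the intermediate value
   theorem, so the zeros of Q are zeros of dQ/dz, which has smaller degree, and
   Bezout applies to Q and dQ/dz.
   The Bezout bound for irreducible F not dividing G, of degrees m and n, with N
   common zeros with distinct z, is a dimension count in degree d = m + n + N:
   with L_i interpolating at the zeros, the relations a F + b G + sum c_i L_i = 0
   have c = 0, hence are multiples of the relation (G, -F) because F is prime. *)

(** * Irreducible bivariate polynomials are prime *)

Section BivariateGauss.
Import Pdiv.Idomain.

(** Specialization of the inner variable at [a], with values in the domain [{poly K}]. By the next
    lemma whatever it kills is a multiple of ['X - a%:P], which makes this linear factor prime. *)
Definition eval_inner (K : closedFieldType) (a : K) (A : {poly {poly K}}) : {poly K} :=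
  map_poly (horner_eval a) A.

Lemma eval_inner0P (K : closedFieldType) (a : K) (A : {poly {poly K}}) :
  eval_inner a A = 0 -> exists B, A = ('X - a%:P) *: B.
Proof.
move=> A0; exists (map_poly (fun p => p %/ ('X - a%:P)) A).
apply/polyP=> i; rewrite coefZ coef_map_id0 ?div0p // mulrC Pdiv.Field.divpK //.
rewrite Pdiv.Field.dvdp_XsubCl /root.
by have := congr1 (fun q : {poly K} => q`_i) A0; rewrite coef_map coef0 /= => /eqP.
Qed.

(* Linear factors of [c] are removed one at a time: each divides [A] or [B]. *)
Lemma scaled_factorization (K : closedFieldType) (c : {poly K}) (Q A B : {poly {poly K}}) :
  c != 0 -> c *: Q = A * B ->
  exists u v A' B',
    [/\ u != 0, v != 0, A = u *: A', B = v *: B' & Q = A' * B'].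
Proof.
have [n] := ubnP (size c); elim: n c A B => // n IHn c A B lt_c c0 eqQ.
have [c1 | c1] := boolP (size c == 1%N).
  have /size_poly1P[e e0 ce] := c1.
  exists c, 1, (e^-1%:P *: A), B; rewrite oner_eq0 scale1r -scalerAl -eqQ !scalerA ce -!polyCM.
  by rewrite divff // mulVf // !scale1r polyC_eq0; split.
have /closed_rootP[a /factor_theorem[d ed]] := c1.
have X0 : 'X - a%:P != 0 :> {poly K} by rewrite polyXsubC_eq0.
have scaleXI : injective (fun C : {poly {poly K}} => ('X - a%:P) *: C).
  move=> C C'; rewrite -!mul_polyC; apply: mulfI; by rewrite polyC_eq0.
have d0 : d != 0 by apply: contraNneq c0 => d0; rewrite ed d0 mul0r.
have lt_d : (size d < n)%N.
  by move: lt_c; rewrite ed size_Mmonic ?monicXsubC // size_XsubC addn2.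
have : eval_inner a A * eval_inner a B = 0.
  rewrite /eval_inner -rmorphM -eqQ ed; apply/polyP => i.
  by rewrite coef_map coefZ coef0 /= /horner_eval !hornerM hornerXsubC subrr mulr0 mul0r.
move/eqP; rewrite mulf_eq0 => /orP[] /eqP /eval_inner0P [C eC].
  have eqC : d *: Q = C * B.
    by apply: scaleXI; rewrite scalerA mulrC -ed eqQ scalerAl -eC.
  have [u [v [A' [B' [u0 v0 eA eB eQ]]]]] := IHn _ _ _ lt_d d0 eqC.
  exists (('X - a%:P) * u), v, A', B'; split => //; first by rewrite mulf_neq0.
  by rewrite eC eA scalerA.
have eqC : d *: Q = A * C.
  by apply: scaleXI; rewrite scalerA mulrC -ed eqQ scalerAr -eC.
have [u [v [A' [B' [u0 v0 eA eB eQ]]]]] := IHn _ _ _ lt_d d0 eqC.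
exists u, (('X - a%:P) * v), A', B'; split => //; first by rewrite mulf_neq0.
by rewrite eC eB scalerA.
Qed.

(* Over the non-field [{poly K}], [%|] only means divisibility up to a nonzero
   scalar in [{poly K}]; for primitive [F] it is genuine divisibility. *)
Lemma primitive_dvdp (K : closedFieldType) (F Q : {poly {poly K}}) :
  (forall a, eval_inner a F != 0) -> F %| Q -> exists H, Q = F * H.
Proof.
move=> primF /dvdpP[[c q] /= c0 eqQ].
have [u [v [q' [F' [u0 v0 _ eF eQ]]]]] := scaled_factorization c0 eqQ.
(* [v] divides every coefficient of the primitive [F], so it has no root and is a nonzero
   constant. *)
have [v1 | v1] := boolP (size v == 1%N).
  have /size_poly1P[e e0 ve] := v1.
  exists (e^-1%:P *: q'); rewrite eQ eF ve -scalerAl -scalerAr scalerA -polyCM.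
  by rewrite divff // scale1r mulrC.
have /closed_rootP[a /eqP va] := v1.
have /eqP[] := primF a; rewrite eF; apply/polyP => i.
by rewrite coef_map coefZ coef0 /= /horner_eval hornerM va mul0r.
Qed.

Definition bi_const (K : closedFieldType) (A : {poly {poly K}}) := exists c : K, A = c%:P%:P.

(** If [F] is free of the outer variable, it is up to a constant some ['X - x], prime by
    specialization at [x]. Otherwise [F] is primitive, and division up to scalars suffices: either
    the gcd of [F] and [G] is associate to [F], or they are coprime and Gauss's lemma gives [F]
    dividing [b]. *)
Lemma irreducible_prime (K : closedFieldType) (F G a b : {poly {poly K}}) :
  F != 0 -> ~ bi_const F ->
  (forall A B, F = A * B -> bi_const A \/ bi_const B) ->
  F * a = G * b -> (exists H, G = F * H) \/ (exists H, b = F * H).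
Proof.
move=> F0 Fnc Firr eqFG.
have [F1 | F1] := leqP (size F) 1.
  have /size_poly1P[f f0 eF] : size F == 1%N by rewrite eqn_leq F1 size_poly_gt0.
  have /closed_rootP[x] : size f != 1%N.
    apply/negP => /size_poly1P[c _ ef]; apply: Fnc; exists c; by rewrite eF ef.
  case/factor_theorem => g eg.
  have eFX : F = g%:P * ('X - x%:P)%:P by rewrite -polyCM -eg.
  have [[c ec] | [c /polyC_inj /(congr1 (size : {poly K} -> nat))]] := Firr _ _ eFX; last first.
    by rewrite size_XsubC size_polyC; case: eqP.
  have c0 : c != 0 by apply: contraNneq F0 => c0; rewrite eFX ec c0 mul0r.
  have eFc : F = (c%:P * ('X - x%:P))%:P by rewrite eFX ec -polyCM.
  have dvdF A : eval_inner x A = 0 -> exists H, A = F * H.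
    case/eval_inner0P => H ->; exists (c^-1%:P%:P * H).
    by rewrite eFc mulrA -polyCM mulrAC -polyCM divff // mul1r mul_polyC.
  have : eval_inner x G * eval_inner x b = 0.
    rewrite /eval_inner -rmorphM -eqFG eFc (mul_polyC (_ * _)); apply/polyP => i.
    rewrite coef_map coefZ coef0 /= /horner_eval !hornerM hornerXsubC subrr.
    by rewrite mulr0 mul0r.
  by move/eqP; rewrite mulf_eq0 => /orP[] /eqP /dvdF; [left | right].
have primF x : eval_inner x F != 0.
  apply/eqP => /eval_inner0P [H]; rewrite -mul_polyC => eF.
  have [[c /polyC_inj /(congr1 (size : {poly K} -> nat))] | [c ec]] := Firr _ _ eF.
    by rewrite size_XsubC size_polyC; case: eqP.
  by move: F1; rewrite eF ec -polyCM size_polyC; case: eqP.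
(* The gcd divides [F] only up to a factor in [{poly K}]; clearing it yields a true factorization
   [F = q' * D], to which irreducibility applies. *)
have /dvdpP[[c q] /= c0 eqF] := dvdp_gcdl F G.
have [u [v [q' [D [u0 v0 eq eD eF]]]]] := scaled_factorization c0 eqF.
have [[e ee] | [e ee]] := Firr _ _ eF.
  left; apply: primitive_dvdp => //.
  suff /(eqp_dvdl G) <- : gcdp F G %= F by rewrite dvdp_gcdr.
  rewrite -dvdp_size_eqp ?dvdp_gcdl // eD size_scale //.
  have e0 : e != 0 by apply: contraNneq F0 => e0; rewrite eF ee e0 mul0r.
  by rewrite eF ee mul_polyC size_scale ?polyC_eq0.
right; apply: primitive_dvdp => //.
have copFG : coprimep F G.
  rewrite coprimep_def eD size_scale // ee size_polyC polyC_eq0.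
  by rewrite (contraNneq _ F0) // => e0; rewrite eF ee e0 mulr0.
by rewrite -(Gauss_dvdpr _ copFG) -eqFG dvdp_mulr.
Qed.

End BivariateGauss.

(** * Transfer to polynomials in two variables *)

Definition bipoly (K : closedFieldType) : {mpoly K[2]} -> {poly {poly K}} :=
  mmap (polyC \o polyC) (fun i => if i == ord0 then 'X%:P else 'X).

HB.instance Definition _ (K : closedFieldType) := GRing.RMorphism.on (@bipoly K).

Lemma coef_bipoly (K : closedFieldType) (P : {mpoly K[2]}) i j :
  (bipoly P)`_j`_i = P@_[multinom if k == ord0 then i else j | k < 2].
Proof.
rewrite /bipoly /mmap [in RHS](mpolyE P) !coef_sum [RHS]raddf_sum; apply: eq_bigr => m _.
rewrite /= mcoeffZ mcoeffX /mmap1 big_ord_recl big_ord1 /= -polyC_exp mulrA -polyCM.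
rewrite coefCM coefXn mulr_natr coefMn coefCM coefXn -mulrnAr; congr (_ * _).
rewrite -mulr_natr -natrM mulnb; congr (_%:R); congr nat_of_bool.
apply/andP/eqP => [[/eqP -> /eqP ->] | ->]; last by rewrite !mnmE.
apply/mnmP => k; rewrite mnmE; case: eqP => [-> // | /eqP k0].
by congr (m _); apply/val_inj; case: k k0 => [[|[|]]].
Qed.

Lemma bipoly_inj (K : closedFieldType) : injective (@bipoly K).
Proof.
move=> P Q ePQ; apply/mpolyP => m.
have -> : m = [multinom if k == ord0 then m ord0 else m ord_max | k < 2].
  apply/mnmP => k; rewrite mnmE; case: eqP => [-> // | /eqP k0].
  by congr (m _); apply/val_inj; case: k k0 => [[|[|]]].
by rewrite -!coef_bipoly ePQ.
Qed.

Lemma bipolyC (K : closedFieldType) (c : K) : bipoly c%:MP = c%:P%:P.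
Proof. by rewrite /bipoly mmapC. Qed.

Lemma bipoly_surj (K : closedFieldType) (A : {poly {poly K}}) : exists P, bipoly P = A.
Proof.
elim/poly_ind: A => [|A p [P <-]]; first by exists 0; rewrite rmorph0.
have [Q <-] : exists Q, bipoly Q = p%:P.
  elim/poly_ind: p => [|p c [Q eQ]]; first by exists 0; rewrite rmorph0.
  exists (Q * 'X_ord0 + c%:MP).
  by rewrite rmorphD rmorphM /= eQ bipolyC /bipoly mmapX mmap1U polyCD polyCM.
exists (P * 'X_ord_max + Q).
by rewrite rmorphD rmorphM /= /bipoly mmapX mmap1U.
Qed.

Definition mp_irreducible (K : closedFieldType) (F : {mpoly K[2]}) :=
  (1 < msize F)%N /\ forall A B, F = A * B -> (msize A <= 1)%N \/ (msize B <= 1)%N.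

Lemma mp_irreducible_prime (K : closedFieldType) (F G a b : {mpoly K[2]}) :
  mp_irreducible F -> F * a = G * b -> (exists H, G = F * H) \/ (exists H, b = F * H).
Proof.
move=> [F1 Firr] eqFG.
have constP A : (msize A <= 1)%N -> bi_const (bipoly A).
  by move=> /msize1_polyC ->; exists (A@_0)%MM; rewrite bipolyC.
have [||A B eF|||] := @irreducible_prime _ (bipoly F) (bipoly G) (bipoly a) (bipoly b).
- by apply: contraTneq F1; rewrite -(rmorph0 (@bipoly K)) => /bipoly_inj ->; rewrite msize0.
- by move=> [c]; rewrite -bipolyC => /bipoly_inj eF; move: F1; rewrite eF msizeC; case: eqP.
- have [P eP] := bipoly_surj A; have [Q eQ] := bipoly_surj B.
  move: eF; rewrite -eP -eQ -rmorphM => /bipoly_inj /Firr.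
  by case=> /constP; [left | right].
- by rewrite -!rmorphM eqFG.
- move=> [H]; have [P <-] := bipoly_surj H; rewrite -rmorphM => /bipoly_inj ->.
  by left; exists P.
move=> [H]; have [P <-] := bipoly_surj H; rewrite -rmorphM => /bipoly_inj ->.
by right; exists P.
Qed.

(** * The Bezout bound *)

(** There are [k + 1] monomials of degree [k]; summing over [k < d] gives a triangular number. *)
Lemma card_bmultinom2 (d : nat) : #|{: 'X_{1..2 < d}}| = 'C(d.+1, 2).
Proof.
pose T := {: 'X_{1..2 < d}}.
have eqT (k : 'I_d) : #|[pred m : 'X_{1..2 < d} | mdeg m == k]| = k.+1.
  rewrite -[RHS](binSn k) -(addn1 k) -size_basis.
  rewrite cardE -(size_map val); apply/perm_size/uniq_perm.
  - by rewrite map_inj_uniq ?enum_uniq //; apply: val_inj.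
  - exact: uniq_basis.
  move=> m; rewrite -basis_cover; apply/mapP/idP => [[b]|mk].
    by rewrite mem_enum inE => mk ->.
  have mb : (mdeg m < d)%N by rewrite (eqP mk).
  by exists (BMultinom mb) => //; rewrite mem_enum inE.
rewrite -sum1_card (partition_big (fun m : 'X_{1..2 < d} => Ordinal (bmdeg m)) xpredT) //=.
rewrite -triangular_sum big_mkord big_ord_recl add0n; apply: eq_bigr => k _.
by rewrite -[RHS]eqT -sum1_card; apply: eq_bigl => m; rewrite inE -val_eqE.
Qed.

Lemma card_bmultinom2_add (m n N : nat) :
  (#|{: 'X_{1..2 < (m + n + N).+1}}| + #|{: 'X_{1..2 < N.+1}}| =
   m * n + #|{: 'X_{1..2 < (n + N).+1}}| + #|{: 'X_{1..2 < (m + N).+1}}|)%N.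
Proof.
rewrite !card_bmultinom2.
have bin2E k : ('C(k.+2, 2) * 2 = k.+2 * k.+1)%N by rewrite muln2 bin2 -[RHS]odd_double_half oddM /= andNb.
move: (bin2E (m + n + N)%N) (bin2E N) (bin2E (n + N)%N) (bin2E (m + N)%N).
move: 'C(_, _) 'C(_, _) 'C(_, _) 'C(_, _) => a b c d; nia.
Qed.

(** Rank-nullity: the kernel of [g] lies in the image of [f]. *)
Lemma dim_exact (K : fieldType) (U V W : vectType K) (f : U -> V) (g : V -> W) :
  linear f -> linear g -> (forall v, g v = 0 -> exists u, v = f u) ->
  (dim V <= dim U + dim W)%N.
Proof.
move=> lin_f lin_g exact_fg.
pose fM := GRing.isLinear.Build _ _ _ _ f lin_f.
pose fL : {linear U -> V} := HB.pack f fM.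
pose gM := GRing.isLinear.Build _ _ _ _ g lin_g.
pose gL : {linear V -> W} := HB.pack g gM.
rewrite -!dimvf -(limg_ker_dim (linfun gL) fullv) capfv leq_add ?dimvS ?subvf //.
apply: leq_trans (_ : \dim (limg (linfun fL)) <= _)%N.
  apply/dimvS/subvP => v; rewrite memv_ker lfunE => /eqP /exact_fg[u ->].
  by rewrite -[f u](lfunE fL) memv_img ?memvf.
by rewrite -(limg_ker_dim (linfun fL) fullv) leq_addl.
Qed.

Lemma msizeM_leq (n : nat) (R : idomainType) (P Q : {mpoly R[n]}) (a b : nat) :
  (msize P <= a.+1)%N -> (msize Q <= b.+1)%N -> (msize (P * Q) <= (a + b).+1)%N.
Proof.
move=> Pa Qb; have [-> | P0] := eqVneq P 0; first by rewrite mul0r msize0.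
have [-> | Q0] := eqVneq Q 0; first by rewrite mulr0 msize0.
by rewrite msizeM //; lia.
Qed.

Lemma msizeD_leq (n : nat) (R : idomainType) (P Q : {mpoly R[n]}) (a : nat) :
  (msize P <= a)%N -> (msize Q <= a)%N -> (msize (P + Q) <= a)%N.
Proof. by move=> Pa Qa; apply: leq_trans (msizeD_le _ _) _; rewrite geq_max Pa. Qed.

(** Polynomials of degree at most [d] as coefficient vectors, a space of finite dimension. *)
Definition bounded_coefs (K : closedFieldType) (d : nat) :=
  {ffun 'X_{1..2 < d.+1} -> K^o}.

Definition bounded_mpoly (K : closedFieldType) (d : nat) (v : bounded_coefs K d) :
  {mpoly K[2]} := \sum_m (v m : K) *: 'X_[m].

Definition coefs_of (K : closedFieldType) (d : nat) (P : {mpoly K[2]}) : bounded_coefs K d :=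
  [ffun m : 'X_{1..2 < d.+1} => P@_m : K^o].
Arguments coefs_of {K} d P.

Lemma dim_bounded_coefs (K : closedFieldType) (d : nat) :
  dim (bounded_coefs K d) = #|{: 'X_{1..2 < d.+1}}|.
Proof. exact: muln1. Qed.

Lemma coefs_ofK (K : closedFieldType) (d : nat) (P : {mpoly K[2]}) :
  (msize P <= d.+1)%N -> bounded_mpoly (coefs_of d P) = P.
Proof.
move=> Pd; rewrite [RHS](mpolywE Pd); apply: eq_bigr => m _.
by rewrite ffunE.
Qed.

Lemma bounded_mpolyK (K : closedFieldType) (d : nat) :
  cancel (@bounded_mpoly K d) (coefs_of d).
Proof.
move=> v; apply/ffunP => m; rewrite ffunE raddf_sum /= (bigD1 m) //= big1 => [|m' m'm].
  by rewrite mcoeffZ mcoeffX eqxx mulr1 addr0.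
by rewrite mcoeffZ mcoeffX -bmeqP (negPf m'm) mulr0.
Qed.

Lemma bounded_mpoly_linear (K : closedFieldType) (d : nat) : linear (@bounded_mpoly K d).
Proof.
move=> a u v; rewrite /bounded_mpoly scaler_sumr -big_split; apply: eq_bigr => m _ /=.
by rewrite !ffunE scalerDl scalerA.
Qed.

Lemma coefs_of_linear (K : closedFieldType) (d : nat) : linear (@coefs_of K d).
Proof. by move=> a P Q; apply/ffunP => m; rewrite !ffunE mcoeffD mcoeffZ. Qed.

Lemma msize_bounded_mpoly (K : closedFieldType) (d : nat) (v : bounded_coefs K d) :
  (msize (bounded_mpoly v) <= d.+1)%N.
Proof.
rewrite /bounded_mpoly; elim/big_ind: _ => [|P Q Pd Qd|m _]; first by rewrite msize0.
  exact: msizeD_leq.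
by apply: leq_trans (msizeZ_le _ _) _; rewrite msizeX bmdeg.
Qed.

(* [coefs_of d] truncates polynomials of degree above [d]; the choice
   [d = m + n + N] makes every polynomial below fit. *)
Lemma bezout_bound (K : closedFieldType) (F G : {mpoly K[2]}) (v : K -> 'I_2 -> K) (s : seq K) :
  mp_irreducible F -> (forall H, G <> F * H) -> (forall z, v z ord0 = z) ->
  uniq s -> (forall z, z \in s -> F.@[v z] = 0 /\ G.@[v z] = 0) ->
  (size s <= (msize F).-1 * (msize G).-1)%N.
Proof.
move=> Firr FnG v0 s_uniq s0.
have F0 : F != 0 by case: Firr; case: eqP => // ->; rewrite msize0.
have G0 : G != 0 by apply/eqP => G0; case: (FnG 0); rewrite mulr0.
set m := (msize F).-1; set n := (msize G).-1; set N := size s.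
have Fm : msize F = m.+1 by rewrite prednK // lt0n msize_poly_eq0.
have Gn : msize G = n.+1 by rewrite prednK // lt0n msize_poly_eq0.
(* Interpolation in the first coordinate: among the zeros, [L i] is nonzero only at the [i]-th. *)
pose L (i : 'I_N) : {mpoly K[2]} := \prod_(j < N | j != i) ('X_ord0 - (s`_j)%:MP).
have LN i : (msize (L i) <= N.+1)%N.
  have : (msize (L i) <= (\sum_(j < N | j != i) 1).+1)%N.
    rewrite /L; elim/big_ind2: _ => [|P a Q b Pa Qb|j _]; first by rewrite msize1.
      exact: msizeM_leq.
    by apply: msizeD_leq; rewrite ?msizeN ?msizeX ?mdeg1 // msizeC; case: eqP.
  by move=> /leq_trans -> //; rewrite ltnS sum1_card (leq_trans (max_card _)) ?card_ord.
have evalL i j : (L i).@[v s`_j] = \prod_(k < N | k != i) (s`_j - s`_k).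
  rewrite /L rmorph_prod; apply: eq_bigr => k _.
  by rewrite /= mevalB mevalXU mevalC v0.
pose a_ (w : bounded_coefs K (n + N) * bounded_coefs K (m + N) * {ffun 'I_N -> K^o}) :=
  bounded_mpoly w.1.1.
pose b_ (w : bounded_coefs K (n + N) * bounded_coefs K (m + N) * {ffun 'I_N -> K^o}) :=
  bounded_mpoly w.1.2.
(* [g] sends [(a, b, c)] to the coefficients of [a F + b G + sum c_i L_i]; [f] below sends [u] to
   the trivial relation [(u G, - u F, 0)]. *)
pose h w : {mpoly K[2]} := a_ w * F + b_ w * G + \sum_i (w.2 i : K) *: L i.
pose g w := coefs_of (m + n + N) (h w).
pose f (u : bounded_coefs K N) :
    bounded_coefs K (n + N) * bounded_coefs K (m + N) * {ffun 'I_N -> K^o} :=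
  (coefs_of (n + N) (bounded_mpoly u * G), coefs_of (m + N) (bounded_mpoly u * - F), 0).
have lin_f : linear f.
  move=> c u w; rewrite /f bounded_mpoly_linear !mulrDl -!scalerAl !coefs_of_linear.
  by congr (_, _, _); rewrite /= scaler0 addr0.
have lin_g : linear g.
  move=> c u w; rewrite -coefs_of_linear; congr (coefs_of _ _).
  rewrite /h /a_ /b_ /= !bounded_mpoly_linear !scalerDr !mulrDl -!scalerAl.
  rewrite [RHS]addrACA [X in X + _ = _]addrACA [c *: \sum_(i < N) _]scaler_sumr -big_split; congr (_ + _).
  by apply: eq_bigr => i _; rewrite !ffunE scalerDl scalerA.
have exact_fg w : g w = 0 -> exists u, w = f u.
  move=> gw0; have hw0 : h w = 0.
    rewrite -(@coefs_ofK _ (m + n + N) (h w)).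
      rewrite -/(g w) gw0 /bounded_mpoly big1 // => i _; by rewrite ffunE scale0r.
    apply: msizeD_leq; first apply: msizeD_leq.
    - by rewrite -addnA addnC; apply: msizeM_leq; rewrite ?Fm ?msize_bounded_mpoly.
    - by rewrite addnAC; apply: msizeM_leq; rewrite ?Gn ?msize_bounded_mpoly.
    elim/big_ind: _ => [|P Q|i _]; [by rewrite msize0 | exact: msizeD_leq |].
    apply: leq_trans (msizeZ_le _ _) _; apply: leq_trans (LN i) _.
    by rewrite ltnS leq_addl.
  (* At the [i]-th zero [F], [G] and the other [L k] vanish, leaving [w.2 i] times a nonzero
     product. *)
  have w2 : w.2 = 0.
    apply/ffunP => i; have [Fi Gi] := s0 _ (mem_nth 0 (ltn_ord i)).
    have := congr1 (meval (v s`_i)) hw0.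
    rewrite /h !mevalD !mevalM Fi Gi !mulr0 !add0r meval0 raddf_sum /= (bigD1 i) //=.
    rewrite big1 => [|k ki]; last first.
      rewrite mevalZ evalL (bigD1 i) 1?eq_sym //=.
      by rewrite subrr mul0r mulr0.
    rewrite addr0 mevalZ evalL ffunE => /eqP; rewrite mulf_eq0 => /orP[/eqP //|].
    case/prodf_eq0 => k ki; rewrite subr_eq0 nth_uniq // => /eqP/val_inj ik.
    by rewrite ik eqxx in ki.
  have eFG : F * a_ w = G * - b_ w.
    move: hw0; rewrite /h w2 big1 => [|i _]; last by rewrite ffunE scale0r.
    by rewrite addr0 => /eqP; rewrite addr_eq0 mulrC mulrN [G * _]mulrC => /eqP.
  (* [F] is prime and does not divide [G], so it divides [- b_ w]; the cofactor [H] is the preimage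
     under [f]. *)
  have [[H /FnG //]|[H eb]] := mp_irreducible_prime Firr eFG.
  have ea : a_ w = G * H.
    by apply: (mulfI F0); rewrite eFG eb mulrCA.
  have HN : (msize H <= N.+1)%N.
    have [-> | H0] := eqVneq H 0; first by rewrite msize0.
    have := msize_bounded_mpoly w.1.2; rewrite -/(b_ w) -msizeN eb msizeM // Fm.
    by rewrite addSn /= -addnS leq_add2l.
  exists (coefs_of N H); rewrite /f coefs_ofK // [H * G]mulrC -ea mulrN [H * F]mulrC -eb opprK.
  by rewrite !bounded_mpolyK -w2; case: (w) => [[]].
(* With [c(k)] monomials of degree at most [k], this reads [c(n+N) + c(m+N) + N <= c(N) + c(m+n+N)];
   the counting identity leaves [N <= m * n]. *)
have := dim_exact lin_f lin_g exact_fg.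
have -> : dim (bounded_coefs K (n + N) * bounded_coefs K (m + N) * {ffun 'I_N -> K^o})%type =
    (#|{: 'X_{1..2 < (n + N).+1}}| + #|{: 'X_{1..2 < (m + N).+1}}| + N)%N.
  rewrite -!(dim_bounded_coefs K) -[X in _ = (_ + X)%N]card_ord -[X in _ = (_ + X)%N]muln1; exact: erefl.
rewrite !dim_bounded_coefs [leqRHS]addnC card_bmultinom2_add -[leqRHS]addnA addnC leq_add2r.
by [].
Qed.

(** * Conjugation and isolated zeros *)

Lemma horner_mmap (n : nat) (R : comNzRingType) (h : 'I_n -> {poly R}) (F : {mpoly R[n]}) (c : R) :
  (mmap polyC h F).[c] = F.@[fun i => (h i).[c]].
Proof.
rewrite /mmap mevalE horner_sum; apply: eq_bigr => m _.
rewrite hornerM hornerC horner_prod; congr (_ * _).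
by apply: eq_bigr => i _; rewrite horner_exp.
Qed.

Lemma mpoly_ind_ring (n : nat) (R : comNzRingType) (P : {mpoly R[n]} -> Prop) :
  (forall c, P c%:MP) -> (forall i, P 'X_i) ->
  (forall A B, P A -> P B -> P (A + B)) -> (forall A B, P A -> P B -> P (A * B)) ->
  forall A, P A.
Proof.
move=> PC PX PD PM; elim/mpolyind => [|c m A _ _ PA]; first by rewrite -mpolyC0.
apply: (PD) => //; rewrite -mul_mpolyC; apply: (PM) => //.
rewrite mpolyXE_id; apply: big_ind => [|A' B'|i _]; [by rewrite -mpolyC1 | exact: PM |].
by elim: (m i) => [|k Pk]; rewrite ?expr0 -?mpolyC1 // exprS; apply: (PM).
Qed.

(** Chain rule along the polynomial curve [h], checked on constants and variables and propagated
    through sums and products. *)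
Lemma deriv_mmap (n : nat) (R : comNzRingType) (h : 'I_n -> {poly R}) (F : {mpoly R[n]}) :
  (mmap polyC h F)^`() = \sum_(i < n) mmap polyC h F^`M(i) * (h i)^`().
Proof.
elim/mpoly_ind_ring: F => [c|i|A B eA eB|A B eA eB].
- by rewrite mmapC derivC big1 // => i _; rewrite mderivC mmap0 mul0r.
- rewrite mmapX mmap1U (bigD1 i) //= big1 => [|j ji]; last first.
    by rewrite mderivX mnm1E eq_sym (negPf ji) scale0r mmap0 mul0r.
  rewrite mderivX mnm1E eqxx scale1r addr0.
  have -> : (U_(i) - U_(i))%MM = 0%MM :> 'X_{1..n} by apply/mnmP => k; rewrite mnmE mnm0E subnn.
  by rewrite mpolyX0 rmorph1 mul1r.
- rewrite rmorphD derivD eA eB -big_split; apply: eq_bigr => i _ /=.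
  by rewrite mderivD rmorphD mulrDl.
rewrite rmorphM derivM eA eB mulr_suml mulr_sumr -big_split; apply: eq_bigr => i _ /=.
rewrite mderivM rmorphD !rmorphM /=; ring.
Qed.

(** * The conjugate polynomial *)

Lemma meval_msym_map (n : nat) (K L : comNzRingType) (f : {rmorphism K -> L}) (s : 'S_n)
    (F : {mpoly K[n]}) (v : 'I_n -> L) (w : 'I_n -> K) :
  (forall i, v (s i) = f (w i)) -> (msym s (map_mpoly f F)).@[v] = f F.@[w].
Proof.
move=> vw; elim/mpoly_ind_ring: F => [c|i|A B eA eB|A B eA eB].
- by rewrite map_mpolyC /msym mmapC !mevalC.
- by rewrite map_mpolyX /msym mmapX mmap1U !mevalXU.
- by rewrite rmorphD msymD !mevalD eA eB rmorphD.
by rewrite rmorphM msymM !mevalM eA eB rmorphM.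
Qed.

(* [P(z, w) |-> conj (P (conj w, conj z))], so that a polynomial fixed by [star]
   takes real values on the points [(z, conj z)]. *)
HB.lock Definition star (R : rcfType) (F : {mpoly R[i][2]}) : {mpoly R[i][2]} :=
  msym (tperm ord0 ord_max) (map_mpoly (@conjc R) F).

Section Star.
Variable R : rcfType.
Implicit Types F G : {mpoly R[i][2]}.

Definition mswap (m : 'X_{1..2}) : 'X_{1..2} := [multinom m (tperm ord0 ord_max i) | i < 2].

Lemma mcoeff_star F m : (star F)@_m = conjc F@_(mswap m).
Proof. rewrite star.unlock mcoeff_sym mcoeff_map_mpoly /=; exact: erefl. Qed.

Lemma mswapK : involutive mswap.
Proof. by move=> m; apply/mnmP => i; rewrite !mnmE tpermK. Qed.

Lemma mdeg_swap m : mdeg (mswap m) = mdeg m.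
Proof. exact: mdeg_mperm. Qed.

Lemma starK : involutive (@star R).
Proof. by move=> F; apply/mpolyP => m; rewrite !mcoeff_star mswapK conjcK. Qed.

Lemma starD F G : star (F + G) = star F + star G.
Proof.
apply/mpolyP => m; rewrite mcoeffD.
rewrite !mcoeff_star.
rewrite mcoeffD.
exact: (rmorphD (@conjc R)).
Qed.

Lemma starZ c F : star (c *: F) = conjc c *: star F.
Proof.
apply/mpolyP => m; rewrite mcoeffZ !mcoeff_star mcoeffZ.
exact: (rmorphM (@conjc R)).
Qed.

Lemma msize_star F : msize (star F) = msize F.
Proof.
have le G : (msize (star G) <= msize G)%N.
  rewrite [leqLHS]msizeE; apply/bigmax_leqP_seq => m; rewrite mcoeff_msupp mcoeff_star => Gm _.
  rewrite -mdeg_swap; apply: msize_mdeg_lt; rewrite mcoeff_msupp.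
  by apply: contraNneq Gm => ->; rewrite conjc0.
by apply/eqP; rewrite eqn_leq le -{1}[F]starK le.
Qed.

(** When [star F = F], the two partial derivatives are therefore conjugate, and one vanishes with
    the other. *)
Lemma mderiv_star F : (star F)^`M(ord_max) = star F^`M(ord0).
Proof.
apply/mpolyP => m; rewrite mcoeff_star !mcoeff_mderiv mcoeff_star rmorphMn /=.
rewrite mnmE tpermL; congr (conjc _@_ _ *+ _).
by apply/mnmP => i; rewrite !mnmE; congr (_ + _)%N; case: tpermP => [->|->|/eqP i0 /eqP i1] //; case: i i0 i1 => [[|[|]]].
Qed.

End Star.

(** The map [(z, w) |-> (conj w, conj z)] fixes the points [(z, conj z)]. *)
Lemma pa_eval_star (R : realType) (F : {mpoly R[i][2]}) (z : R[i]) :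
  pa_eval (star F) z = conjc (pa_eval F z).
Proof.
rewrite /pa_eval star.unlock; apply: meval_msym_map => i; rewrite !ffunE.
case: tpermP => [->|->|/eqP i0 /eqP i1]; first by [].
  by rewrite /= conjcK.
by case: i i0 i1 => [[|[|]]].
Qed.

Local Open Scope complex_scope.

(** * Real parts and signs of real polynomials *)

Section RealPart.
Variable R : rcfType.

Lemma ReD (x y : R[i]) : complex.Re (x + y) = complex.Re x + complex.Re y.
Proof. by case: x y => [a b] [c d]. Qed.

Lemma Re_sum (I : Type) (r : seq I) (f : I -> R[i]) :
  complex.Re (\sum_(j <- r) f j) = \sum_(j <- r) complex.Re (f j).
Proof. exact: (big_morph _ ReD erefl). Qed.

Lemma ReMn (x : R[i]) n : complex.Re (x *+ n) = complex.Re x *+ n.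
Proof. by elim: n => // n IHn; rewrite !mulrS ReD IHn. Qed.

Lemma Re_mulr_real (x : R[i]) (t : R) : complex.Re (x * t%:C) = complex.Re x * t.
Proof. by case: x => a b /=; rewrite mulr0 subr0. Qed.

(** On real arguments the real part of [p] is again a polynomial, open to the intermediate value
    theorem. *)
Definition Re_poly (p : {poly R[i]}) : {poly R} := map_poly (@complex.Re R) p.

Lemma coef_Re_poly p j : (Re_poly p)`_j = complex.Re p`_j.
Proof. exact: coef_map_id0. Qed.

Lemma horner_Re_poly p (t : R) : (Re_poly p).[t] = complex.Re p.[t%:C].
Proof.
rewrite (@horner_coef_wide _ (size p)) ?size_poly // horner_coef Re_sum.
by apply: eq_bigr => j _; rewrite coef_Re_poly -rmorphXn Re_mulr_real.
Qed.

Lemma deriv_Re_poly p : (Re_poly p)^`() = Re_poly p^`().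
Proof. by apply/polyP => j; rewrite coef_Re_poly !coef_deriv ReMn coef_Re_poly. Qed.

Lemma poly_sign_near (p : {poly R}) (a : R) :
  p.[a] != 0 -> exists2 e : R, 0 < e & forall y, `|y - a| < e -> 0 < p.[a] * p.[y].
Proof.
move=> pa0; have pa_gt0 : 0 < `|p.[a]| by rewrite normr_gt0.
(* With tolerance [|p(a)|] itself, continuity preserves the sign of [p(a)]. *)
have [e e0 He] := poly_cont a p pa_gt0; exists e => // y /He.
rewrite ltr_norml; have [pa | pa | /eqP] := ltgtP p.[a] 0; last by rewrite (negPf pa0).
  by rewrite ltr0_norm // => ?; nra.
by rewrite gtr0_norm // => ?; nra.
Qed.

(** Write [p = q * 'X]: then [q(0) = p'(0) > 0], so [q] stays positive near 0 and [p] has the sign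
    of its argument. *)
Lemma poly_sign_change (p : {poly R}) :
  p.[0] = 0 -> 0 < p^`().[0] -> exists2 e : R, 0 < e & p.[- e] < 0 < p.[e].
Proof.
move=> p0 dp0; have /factor_theorem[q eq] : root p 0 by apply/eqP.
have q0 : p^`().[0] = q.[0].
  by rewrite eq derivM derivXsubC mulr1 hornerD hornerM hornerXsubC subrr mulr0 add0r.
have [|e e0 He] := @poly_sign_near q 0; first by rewrite -q0 gt_eqF.
have q_gt0 : 0 < q.[0] by rewrite -q0.
have qy y : `|y| < e -> 0 < q.[y].
  by move=> ye; have := He y; rewrite subr0 pmulr_rgt0 //; apply.
have e2 : 0 < e / 2 < e by apply/andP; split; lra.
case/andP: e2 => e1 e2; exists (e / 2) => //.
have ae : `|e / 2| < e by rewrite gtr0_norm.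
by rewrite eq !hornerM !hornerXsubC !subr0 mulrN oppr_lt0 !(pmulr_lgt0 _ e1) !qy ?normrN.
Qed.

Lemma fresh_in_interval (S : seq R) (e : R) :
  0 < e -> exists2 t, 0 < t < e & t \notin S.
Proof.
elim: S e => [|y S IHS] e e0; first by exists (e / 2) => //; apply/andP; split; lra.
have [/andP[y0 ye] | ney] := boolP (0 < y < e).
  have [t /andP[t0 ty] tS] := IHS y y0; exists t; first by rewrite t0 (lt_trans ty).
  by rewrite inE negb_or tS lt_eqF.
have [t te tS] := IHS e e0; exists t => //; rewrite inE negb_or tS andbT.
by apply: contraNneq ney => <-.
Qed.

End RealPart.

(** * Restriction to real lines and isolated zeros *)

Section IsolatedZero.
Variable R : realType.
Implicit Types (F : {mpoly R[i][2]}) (w z u : R[i]).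

(** For real [t] the conjugate of [w + u t] is [conj w + conj u * t], so restricting [F] to a real
    line gives a polynomial in [t]. *)
Definition line_poly F w u : {poly R[i]} :=
  mmap polyC (fun i : 'I_2 => if i == ord0 then w%:P + u *: 'X else (conjc w)%:P + conjc u *: 'X) F.

Lemma horner_line_poly F w u (t : R) : (line_poly F w u).[t%:C] = pa_eval F (w + u * t%:C).
Proof.
rewrite horner_mmap; apply: meval_eq => i; rewrite ffunE; case: ifP => _.
  by rewrite hornerD hornerC hornerZ hornerX.
by rewrite hornerD hornerC hornerZ hornerX rmorphD rmorphM /= oppr0.
Qed.

Lemma deriv_line_poly F w u :
  (line_poly F w u)^`().[0] =
  pa_eval F^`M(ord0) w * u + pa_eval F^`M(ord_max) w * conjc u.
Proof.
rewrite deriv_mmap big_ord_recl big_ord1 /= !derivD !derivC !derivZ !derivX !add0r.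
rewrite hornerD !hornerM !hornerZ !hornerC !mulr1.
have -> : lift ord0 ord0 = ord_max :> 'I_2 by apply/val_inj.
have eval0 G := horner_line_poly G w u 0.
by rewrite !mulr0 !addr0 in eval0; rewrite -!eval0.
Qed.

Lemma pa_eval_real F z : star F = F -> pa_eval F z = (complex.Re (pa_eval F z))%:C.
Proof.
move=> FF; have := pa_eval_star F z; rewrite FF; case: (pa_eval F z) => a b /= [bN].
by congr (_ +i* _); lra.
Qed.

(* At a noncritical zero the real function [F] changes sign along the gradient
   direction [u]; this persists on the parallel lines nearby, and each of them
   carries a zero. *)
Lemma isolated_zero_critical F z :
  star F = F -> pa_finite_zeros F -> pa_zero F z -> pa_zero F^`M(ord0) z.
Proof.
move=> FF [S finF] Fz; apply/eqP; apply: contraT => dFz.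
set d := pa_eval F^`M(ord0) z in dFz.
(* Gradient direction: the derivative of [F] along [u] is [d * conj d + conj d * d], twice the
   squared modulus of [d]. *)
pose u := conjc d.
have divE (K : fieldType) (x v a b c : K) : v != 0 -> (x + v * a * b + v * c - x) / v = a * b + c.
  by move=> v0; field.
have u0 : u != 0 by rewrite conjc_eq0.
pose p w := Re_poly (line_poly F w u).
have pE w t : (p w).[t] = complex.Re (pa_eval F (w + u * t%:C)).
  by rewrite horner_Re_poly horner_line_poly.
have [||e e0 /andP[pNe pe]] := @poly_sign_change _ (p z).
- by rewrite pE mulr0 addr0 Fz.
- rewrite deriv_Re_poly horner_Re_poly deriv_line_poly -FF mderiv_star pa_eval_star FF -/d /u.
  rewrite conjcK [conjc d * d]mulrC -mulr2n ReMn pmulrn_lgt0 //.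
  case: (d) dFz => a b; rewrite eq_complex /= negb_and mulrN opprK -!expr2.
  rewrite lt0r addr_ge0 ?sqr_ge0 // andbT paddr_eq0 ?sqr_ge0 // !sqrf_eq0.
  by rewrite negb_and.
clearbody p.
(* For fixed [t] the value is also polynomial in the sideways offset [s], so its sign persists for
   small [s]. *)
have p_shift s t :
    (p (z + u * 'i * s%:C)).[t] = (Re_poly (line_poly F (z + u * t%:C) (u * 'i))).[s].
  by rewrite pE horner_Re_poly horner_line_poly addrAC.
have p_near t : (p z).[t] != 0 ->
    exists2 e' : R, 0 < e' & forall s, `|s| < e' -> 0 < (p z).[t] * (p (z + u * 'i * s%:C)).[t].
  move: (p_shift 0 t) (p_shift^~ t); move: (Re_poly _) => q.
  rewrite mulr0 addr0 => -> qE /poly_sign_near[e' e'0 He']; exists e' => // s se.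
  by rewrite qE He' // subr0.
have [|e1 e1_gt0 near1] := p_near (- e); first by rewrite lt_eqF.
have [|e2 e2_gt0 near2] := p_near e; first by rewrite gt_eqF.
(* [Im ((x - z) / u)] is the offset of the line through [x]; an offset [s] missed by all of [S]
   gives a line without zeros, contradicting the sign change. *)
have [|s /andP[s0 se] sS] := @fresh_in_interval R [seq complex.Im ((x - z) / u) | x <- S] (Num.min e1 e2).
  by rewrite lt_min e1_gt0.
move: se; rewrite lt_min => /andP[se1 se2].
have := near1 s; have := near2 s; rewrite gtr0_norm // => /(_ se2) pos2 /(_ se1) pos1.
have [||t _ /rootP] := @poly_ivtoo _ (p (z + u * 'i * s%:C)) (- e) e.
- by lra.
- by move: pos1 pos2; rewrite (nmulr_rgt0 _ pNe) (pmulr_rgt0 _ pe) => ? ?; rewrite nmulr_rlt0.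
rewrite pE => Fzero; case/negP: sS; apply/mapP.
exists (z + u * 'i * s%:C + u * t%:C).
  by apply: finF; rewrite /pa_zero pa_eval_real // Fzero.
rewrite divE // /=; ring.
Qed.

End IsolatedZero.

(** * Counting zeros *)

Lemma msize_mderiv (n : nat) (R : numDomainType) (P : {mpoly R[n]}) (i : 'I_n) :
  (msize P^`M(i) <= (msize P).-1)%N.
Proof.
rewrite [leqLHS]msizeE; apply/bigmax_leqP_seq => m; rewrite mcoeff_msupp mcoeff_mderiv => Pm _.
have : (m + U_(i))%MM \in msupp P.
  by rewrite mcoeff_msupp; apply: contraNneq Pm => ->; rewrite mul0rn.
by move/msize_mdeg_lt; rewrite mdegD mdeg1 addn1; case: (msize P).
Qed.

(** In characteristic zero, a monomial containing variable [i] survives differentiation in [i]. *)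
Lemma mderiv_eq0_const (n : nat) (R : numDomainType) (P : {mpoly R[n]}) :
  (forall i, P^`M(i) = 0) -> (msize P <= 1)%N.
Proof.
move=> dP; rewrite msizeE; apply/bigmax_leqP_seq => m; rewrite mcoeff_msupp => Pm _.
rewrite ltnS leqn0 mdeg_eq0; apply/eqP/mnmP => i; rewrite mnm0E; apply/eqP.
apply: contraNT Pm => mi.
have := mcoeff_mderiv i P (m - U_(i))%MM; rewrite dP mcoeff0 submK; last first.
  apply/mnm_lepP => j; rewrite mnm1E; case: eqP => // <-; by rewrite lt0n.
by move/esym/eqP; rewrite mulrn_eq0.
Qed.

Section Main.
Variable R : realType.
Implicit Types P Q A B : {mpoly R[i][2]}.

Lemma pa_evalM A B z : pa_eval (A * B) z = pa_eval A z * pa_eval B z.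
Proof. exact: mevalM. Qed.

Lemma pa_degM A B : A != 0 -> B != 0 -> pa_deg (A * B) = (pa_deg A + pa_deg B)%N.
Proof.
move=> A0 B0; rewrite /pa_deg msizeM //.
rewrite -(msize_poly_eq0 A) in A0; rewrite -(msize_poly_eq0 B) in B0.
by case: (msize A) (msize B) A0 B0 => [|a] [|b] //= _ _; rewrite addnS.
Qed.

Lemma pa_finite_zerosM A B :
  pa_finite_zeros (A * B) -> pa_finite_zeros A /\ pa_finite_zeros B.
Proof.
move=> [S finS]; split; exists S => z Az; apply: finS; rewrite /pa_zero pa_evalM.
  by rewrite Az mul0r.
by rewrite Az mulr0.
Qed.

(** The list is split by whether [A] vanishes; on the remainder [B] must. *)
Lemma pa_at_most_zerosM A B a b :
  pa_at_most_zeros A a -> pa_at_most_zeros B b -> pa_at_most_zeros (A * B) (a + b).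
Proof.
move=> Aa Bb s us s0; rewrite -(count_predC (fun z => pa_eval A z == 0) s) -!size_filter.
apply: leq_add.
  by apply: Aa => [|z]; rewrite ?filter_uniq // mem_filter => /andP[/eqP].
apply: Bb => [|z]; rewrite ?filter_uniq // mem_filter => /andP[/= Az /s0 /eqP].
by rewrite pa_evalM mulf_eq0 (negPf Az) => /eqP.
Qed.

Lemma pa_bezout A B s :
  mp_irreducible A -> (forall H, B <> A * H) -> uniq s ->
  (forall z, z \in s -> pa_zero A z /\ pa_zero B z) -> (size s <= pa_deg A * pa_deg B)%N.
Proof.
move=> irrA AnB us s0.
apply: (@bezout_bound _ _ _ (fun z => [ffun i : 'I_2 => if i == ord0 then z else conjc z])) => //.
by move=> z; rewrite ffunE.
Qed.

(** [star] preserves degree, so [H] is a constant [c]. Then [(1 + c) A = A + star A] is fixed by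
    [star]; if [c = -1], then [i A] is fixed instead. *)
Lemma self_star_associate A H : A != 0 -> star A = A * H ->
  exists2 c, c != 0 & star (c *: A) = c *: A.
Proof.
move=> A0 eqA.
have H0 : H != 0.
  apply: contraNneq A0 => H0; move: eqA; rewrite H0 mulr0 => /(congr1 (@star R)).
  by rewrite starK => ->; rewrite -msize_poly_eq0 msize_star msize0.
have /msize1_polyC eH : (msize H <= 1)%N.
  have := msize_star A; rewrite eqA msizeM //.
  by move: A0; rewrite -msize_poly_eq0; case: (msize A) => // k _; move: (msize H) => h; lia.
move: eqA; rewrite eH mulrC mul_mpolyC; set c := H@_0 => eqA.
have [c1 | c1] := eqVneq (1 + c) 0; last first.
  exists (1 + c) => //; rewrite scalerDl scale1r -eqA starD starK; exact: addrC.
exists 'i%C; first by rewrite eq_complex /= oner_eq0 andbF.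
have cN1 : c = -1 by apply/eqP; rewrite -addr_eq0 addrC c1.
rewrite starZ eqA scalerA cN1 mulrN1; congr (_ *: _).
by apply/eqP; rewrite eq_complex /= oppr0 opprK !eqxx.
Qed.

Lemma irreducible_zeros_bound Q :
  mp_irreducible Q -> pa_finite_zeros Q -> pa_at_most_zeros Q (pa_deg Q ^ 2)%N.
Proof.
move=> irrQ finQ s us s0.
have Q1 : (1 < msize Q)%N by case: irrQ.
have Q0 : Q != 0 by apply: contraTneq Q1 => ->; rewrite msize0.
(* If [Q] does not divide [star Q], Bezout for this pair of equal degrees already gives the
   square. *)
have [[H eqQ] | QnQ] := EM (exists H, star Q = Q * H); last first.
  have -> : (pa_deg Q ^ 2 = pa_deg Q * pa_deg (star Q))%N.
    by rewrite /pa_deg msize_star mulnn.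
  apply: pa_bezout => // [H eqH | z /s0 Qz]; first by apply: QnQ; exists H.
  by split=> //; rewrite /pa_zero pa_eval_star Qz conjc0.
have [c c0 FF] := self_star_associate Q0 eqQ.
have zeroE z : pa_zero (c *: Q) z <-> pa_zero Q z.
  rewrite /pa_zero /pa_eval mevalZ; split=> [/eqP|->]; last by rewrite mulr0.
  by rewrite mulf_eq0 (negPf c0) => /eqP.
have finF : pa_finite_zeros (c *: Q).
  by case: finQ => S finS; exists S => z /zeroE /finS.
have dF_size : (msize (c *: Q)^`M(ord0) <= (msize Q).-1)%N.
  by rewrite (leq_trans (msize_mderiv _ _)) // msizeZ.
(* Otherwise both partial derivatives would vanish and [Q] would be constant. *)
have dF0 : (c *: Q)^`M(ord0) != 0.
  apply: contraTneq Q1 => dF0; rewrite -leqNgt -(msizeZ _ c0).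
  have dF1 : (c *: Q)^`M(ord_max) = 0.
    by rewrite -FF mderiv_star dF0; apply/eqP; rewrite -msize_poly_eq0 msize_star msize0.
  apply: mderiv_eq0_const => i; case: (eqVneq i ord0) => [-> // | i0].
  by rewrite -dF1; congr (_^`M(_)); apply/val_inj; case: i i0 => [[|[|]]].
apply: leq_trans (_ : pa_deg Q * pa_deg (c *: Q)^`M(ord0) <= _)%N; last first.
  rewrite -mulnn leq_mul2l; apply/orP; right.
  by rewrite /pa_deg (leq_trans (leq_pred _)).
apply: pa_bezout => // [G eqG | z /s0 Qz]; last first.
  by split=> //; apply: isolated_zero_critical => //; apply/zeroE.
(* [Q] cannot divide the nonzero derivative, whose degree is smaller. *)
have G0 : G != 0 by apply: contraNneq dF0 => G0; rewrite eqG G0 mulr0.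
move: dF_size; rewrite eqG msizeM //; move: G0 Q1; rewrite -msize_poly_eq0.
by case: (msize G) (msize Q) => // h [|k] // _ _; rewrite addnS /= ltnNge leq_addr.
Qed.

(** Finiteness passes to factors, and a factorization into degrees [a] and [b] costs at most
    [a^2 + b^2 <= (a + b)^2]. *)
Lemma finite_zeros_bound Q :
  Q != 0 -> pa_finite_zeros Q -> pa_at_most_zeros Q (pa_deg Q ^ 2)%N.
Proof.
have [n] := ubnP (msize Q); elim: n Q => // n IHn Q ltQ Q0 finQ.
have [Q1 | Q1] := leqP (msize Q) 1.
  move=> [|z s] // _ /(_ z (mem_head _ _)); move: Q0; rewrite (msize1_polyC Q1).
  by rewrite mpolyC_eq0 /pa_zero /pa_eval mevalC => /eqP.
have [irrQ | redQ] := EM (mp_irreducible Q); first exact: irreducible_zeros_bound.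
have [A [B [eqQ A1 B1]]] : exists A B, [/\ Q = A * B, (1 < msize A)%N & (1 < msize B)%N].
  apply: contrapT => noAB; apply: redQ; split=> // A B eqQ.
  have [A1 | A1] := leqP (msize A) 1; first by left.
  by right; rewrite leqNgt; apply/negP => B1; apply: noAB; exists A, B.
have A0 : A != 0 by apply: contraNneq Q0 => A0; rewrite eqQ A0 mul0r.
have B0 : B != 0 by apply: contraNneq Q0 => B0; rewrite eqQ B0 mulr0.
move: finQ ltQ; rewrite eqQ msizeM // => /pa_finite_zerosM[finA finB] ltQ.
have [ltA ltB] : (msize A < n)%N /\ (msize B < n)%N.
  by move: A1 B1 ltQ; move: (msize A) (msize B) => a b; lia.
move=> s us s0; apply: leq_trans (pa_at_most_zerosM _ _ us s0) _.
- exact: IHn ltA A0 finA.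
- exact: IHn ltB B0 finB.
by rewrite pa_degM // sqrnD leq_addr.
Qed.

Lemma pa_deg_neq0 Q : (1 <= pa_deg Q)%N -> Q != 0.
Proof. by apply: contraTneq => ->; rewrite /pa_deg msize0. Qed.

Lemma pa_deg_prod (Ps : seq {mpoly R[i][2]}) :
  (forall Q, Q \in Ps -> (1 <= pa_deg Q)%N) ->
  \prod_(Q <- Ps) Q != 0 /\
  pa_deg (\prod_(Q <- Ps) Q) = (\sum_(Q <- Ps) pa_deg Q)%N.
Proof.
elim: Ps => [|Q Ps IHPs] degPs.
  by rewrite !big_nil oner_eq0 /pa_deg msize1.
have Q0 := pa_deg_neq0 (degPs Q (mem_head _ _)).
have [|Ps0 degT] := IHPs; first by move=> A PsA; apply: degPs; rewrite inE PsA orbT.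
by rewrite !big_cons mulf_neq0 // pa_degM // degT.
Qed.

Lemma zeros_prod_bound (Ps : seq {mpoly R[i][2]}) :
  (forall Q, Q \in Ps -> (1 <= pa_deg Q)%N) -> pa_finite_zeros (\prod_(Q <- Ps) Q) ->
  pa_at_most_zeros (\prod_(Q <- Ps) Q) (\sum_(Q <- Ps) pa_deg Q ^ 2)%N.
Proof.
elim: Ps => [|Q Ps IHPs] degPs.
  rewrite !big_nil => _ [|z s] // _ /(_ z (mem_head _ _)).
  by rewrite /pa_zero /pa_eval meval1 => /eqP; rewrite oner_eq0.
rewrite !big_cons => /pa_finite_zerosM[finQ finPs].
apply: pa_at_most_zerosM; first apply: finite_zeros_bound => //.
  exact/pa_deg_neq0/degPs/mem_head.
by apply: IHPs => // A PsA; apply: degPs; rewrite inE PsA orbT.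
Qed.

End Main.

Lemma leq_sum_sqr (T : eqType) (r : seq T) (d : T -> nat) :
  (\sum_(x <- r) d x ^ 2 <= (\sum_(x <- r) d x) ^ 2)%N.
Proof.
elim: r => [|x r IHr]; rewrite ?big_nil // !big_cons sqrnD.
by apply: leq_trans (leq_addr _ _); rewrite leq_add2l.
Qed.

(** Two positive terms make the cross term in the square positive. *)
Lemma ltn_sum_sqr (T : eqType) (r : seq T) (d : T -> nat) :
  (1 < size r)%N -> (forall x, x \in r -> 0 < d x)%N ->
  (\sum_(x <- r) d x ^ 2 < (\sum_(x <- r) d x) ^ 2)%N.
Proof.
case: r => [|x [|y r]] // _ d0; rewrite big_cons [X in (_ < X ^ 2)%N]big_cons sqrnD.
rewrite -addn1 leq_add ?leq_add2l ?leq_sum_sqr // muln_gt0 /= muln_gt0 d0 ?mem_head //.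
by rewrite big_cons ltn_addr // d0 // !inE eqxx orbT.
Qed.

Theorem theorem2p13 (R : realType) (P : {mpoly R[i][2]}) (n : nat) :
  pa_deg P = n -> pa_finite_zeros P ->
  (forall Ps : seq {mpoly R[i][2]},
      (2 <= size Ps)%N ->
      (forall Q, Q \in Ps -> (1 <= pa_deg Q)%N) ->
      P = \prod_(Q <- Ps) Q ->
      pa_at_most_zeros P (\sum_(Q <- Ps) (pa_deg Q) ^ 2)%N /\
      (\sum_(Q <- Ps) (pa_deg Q) ^ 2 < n ^ 2)%N) /\
  ((2 <= n)%N -> pa_at_least_zeros P (n ^ 2 - 2 * n + 3)%N -> pa_irreducible P).
Proof.
move=> degP finP; split=> [Ps Ps2 degPs defP | n2 [s [us s0 le_s]] [A [B [defP A1 B1]]]].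
  split; first by rewrite defP; apply: zeros_prod_bound => //; rewrite -defP.
  by rewrite -degP defP (pa_deg_prod degPs).2; apply: ltn_sum_sqr.
have [A0 B0] := (pa_deg_neq0 A1, pa_deg_neq0 B1).
rewrite defP in finP s0; have [finA finB] := pa_finite_zerosM finP.
have le_s' := pa_at_most_zerosM (finite_zeros_bound A0 finA) (finite_zeros_bound B0 finB) us s0.
have := leq_trans le_s le_s'; move: degP A1 B1; rewrite defP pa_degM // => <-.
(* With [n = a + b], [(a - 1)(b - 1) >= 0] gives [2ab >= 2n - 2], so [a^2 + b^2 <= n^2 - 2n + 2],
   one less than assumed. *)
move: (pa_deg A) (pa_deg B) => a b; nia.
Qed.
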